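(* Let $\mathbf{k}$ be a commutative ring with $1$, $V=\mathbf{k}^n$, $S=\mathbf{k}[x_1,\ldots,x_n]=S(V)$. Let $\partial$ be the $S$-module endomorphism of $S\otimes_{\mathbf{k}}T_{\mathbf{k}}(S)$ given by $$\partial\bigl(s\otimes(s_1\otimes s_2\otimes\cdots\otimes s_\ell)\bigr)=s\cdot s_1\otimes(s_2\otimes\cdots\otimes s_\ell)\quad(\ell\geq 1),$$ and $\partial=0$ on $S\otimes_{\mathbf{k}}T^0_{\mathbf{k}}(S)$, and let $\mathscr{R}_\bullet=\bigoplus_{\ell\geq 0}\mathscr{R}_\ell$, where $\mathscr{R}_\ell=S\otimes_{\mathbf{k}}\bigl(\bigoplus_\alpha\mathbb{S}^{\sigma(\alpha)}(V)\bigr)\subseteq S\otimes_{\mathbf{k}}T^\ell_{\mathbf{k}}(S)$, the direct sum being over all compositions $\alpha=(\alpha_1,\ldots,\alpha_\ell)$ of length $\ell$. Then: (i) $\partial$ restricts to an $S$-module endomorphism of $\mathscr{R}_\bullet$. (ii) Upon restriction to $\mathscr{R}_\bullet$, it satisfies $\partial^2=0$.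
   Context: $T_{\mathbf{k}}(S)=\bigoplus_{\ell\ge0}T^\ell_{\mathbf{k}}(S)$ with $T^\ell_{\mathbf{k}}(S)=S^{\otimes_{\mathbf{k}}\ell}$ is the tensor algebra on the $\mathbf{k}$-module $S$, and $S$ acts on $S\otimes_{\mathbf{k}}T_{\mathbf{k}}(S)$ through the left factor. A composition is a finite sequence of positive integers. For the empty composition, $\mathbb{S}^{\sigma(\varnothing)}(V)=\mathbf{k}=T^0_{\mathbf{k}}(S)$, so $\mathscr{R}_0=S\otimes_{\mathbf{k}}\mathbf{k}=S$. Schur functors: for a finite diagram $D$ of cells (matrix-style coordinates, rows listed bottom-to-top $R_1,\dots,R_p$, columns listed left-to-right $C_1,\dots,C_c$), $\mathbb{S}^D(V)$ is the $GL(V)$-submodule of $S^{|R_1|}(V)\otimes_{\mathbf{k}}\cdots\otimes_{\mathbf{k}} S^{|R_p|}(V)$ that is the image of the composite $$\wedge^{|C_1|}(V)\otimes\cdots\otimes\wedge^{|C_c|}(V)\to V^{\otimes |D|}\to S^{|R_1|}(V)\otimes\cdots\otimes S^{|R_p|}(V),$$ where tensor positions of $V^{\otimes|D|}$ are indexed by cells of $D$, the first map is the tensor product over columns of the antisymmetrizations $v_1\wedge\cdots\wedge v_\ell\mapsto\sum_{w\in\mathfrak{S}_\ell}\operatorname{sgn}(w)\,v_{w(1)}\otimes\cdots\otimes v_{w(\ell)}$ (placed in the cells of that column from top to bottom), and the second map multiplies together the entries in each row. Ribbons: $\sigma(\alpha)$ is the ribbon skew diagram whose row sizes from bottom to top are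 $\alpha_1,\ldots,\alpha_\ell$, each row's rightmost cell lying in the same column as the leftmost cell of the row just above it, and no other column overlaps. Thus $\mathbb{S}^{\sigma(\alpha)}(V)\subseteq S^{\alpha_1}(V)\otimes\cdots\otimes S^{\alpha_\ell}(V)\subseteq T^\ell_{\mathbf{k}}(S)$, where $S^j(V)=S_j$ is the degree $j$ component of $S$. *)

(* Defs.v *)
From HB Require Import structures.
From mathcomp Require Import all_boot all_order perm all_algebra.
From mathcomp Require Import finmap.
From mathcomp.multinomials Require Import monalg.
From mathcomp.multinomials Require mpoly.
From mathcomp Require Import boolp.

Set Implicit Arguments.
Unset Strict Implicit.
Unset Printing Implicit Defensive.

Import GRing.Theory.
Local Open Scope ring_scope.
Local Open Scope quotient_scope.

Section Span.
Variables (R : pzRingType) (M : lmodType R) (P : M -> Prop).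

Definition spanned : {pred M} := fun x =>
  `[< exists s : seq (R * M),
        (forall p, p \in s -> P p.2) /\ x = \sum_(p <- s) p.1 *: p.2 >].

Lemma spannedP x :
  reflect (exists s : seq (R * M),
             (forall p, p \in s -> P p.2) /\ x = \sum_(p <- s) p.1 *: p.2)
          (x \in spanned).
Proof. exact: asboolP. Qed.

Lemma spanned_gen x : P x -> x \in spanned.
Proof.
move=> Px; apply/spannedP; exists [:: (1, x)]; split.
  by move=> p; rewrite inE => /eqP ->.
by rewrite big_seq1 scale1r.
Qed.

Lemma spanned_submod_closed : submod_closed spanned.
Proof.
split=> [|a x y /spannedP [s [Ps ->]] /spannedP [t [Pt ->]]]; apply/spannedP.
  by exists [::]; rewrite big_nil.
exists ([seq (a * p.1, p.2) | p <- s] ++ t); split=> [p|].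
  by rewrite mem_cat => /orP[/mapP [q /Ps Pq ->]|/Pt].
rewrite big_cat big_map scaler_sumr; congr (_ + _).
by apply: eq_bigr => p _; rewrite scalerA.
Qed.

HB.instance Definition _ :=
  GRing.isSubmodClosed.Build R M spanned spanned_submod_closed.

End Span.

(* The k-module with generators X and relators rels: the quotient of the free
   module {malg k[X]} by the submodule spanned by rels *)
Section Presented.
Variables (k : comNzRingType) (X : choiceType) (rels : {malg k[X]} -> Prop).

Definition presented := Quotient.quot (spanned rels).

HB.instance Definition _ := Choice.on presented.
HB.instance Definition _ := GRing.Zmodule.on presented.

Fact presented_key : unit. Proof. by []. Qed.

Definition pproj : {malg k[X]} -> presented :=
  locked_with presented_key \pi_presented.

Definition gen (x : X) : presented := pproj << x >>.

Lemma pproj_zmod_morphism : zmod_morphism pproj.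
Proof. by rewrite /pproj unlock; apply: (@pi_is_zmod_morphism _ _ _ presented). Qed.

HB.instance Definition _ :=
  GRing.isZmodMorphism.Build _ _ pproj pproj_zmod_morphism.

Lemma pproj_eq x y : (pproj x == pproj y) = (x - y \in spanned rels).
Proof. by rewrite /pproj unlock Quotient.idealrBE. Qed.

Lemma pproj_eq0 x : (pproj x == 0) = (x \in spanned rels).
Proof. by rewrite -(raddf0 pproj) pproj_eq subr0. Qed.

Lemma pproj_rel r : rels r -> pproj r = 0.
Proof. by move=> /spanned_gen; rewrite -pproj_eq0 => /eqP. Qed.

Lemma pprojK (q : presented) : pproj (repr q) = q.
Proof. by rewrite /pproj unlock; apply: reprK. Qed.

Definition pscale : k -> presented -> presented :=
  locked_with presented_key (fun a q => pproj (a *: repr q)).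

Lemma pscaleE a m : pscale a (pproj m) = pproj (a *: m).
Proof.
apply/eqP; rewrite /pscale unlock pproj_eq -scalerBr rpredZ //.
by rewrite -pproj_eq pprojK.
Qed.

Lemma pscaleA a b q : pscale a (pscale b q) = pscale (a * b) q.
Proof. by rewrite -(pprojK q) !pscaleE scalerA. Qed.

Lemma pscale1 : left_id 1 pscale.
Proof. by move=> q; rewrite -(pprojK q) pscaleE scale1r. Qed.

Lemma pscaleDr : right_distributive pscale +%R.
Proof.
move=> a p q; rewrite -(pprojK p) -(pprojK q) -raddfD !pscaleE scalerDr.
exact: raddfD.
Qed.

Lemma pscaleDl q : {morph pscale^~ q : a b / a + b}.
Proof. by move=> a b; rewrite -(pprojK q) !pscaleE scalerDl raddfD. Qed.

HB.instance Definition _ := GRing.Zmodule_isLmodule.Build k presented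
  pscaleA pscale1 pscaleDr pscaleDl.

Lemma pprojZ : scalable pproj.
Proof. by move=> a m; rewrite -pscaleE. Qed.

HB.instance Definition _ := GRing.isScalable.Build k _ _ _ pproj pprojZ.

Lemma gen_linear a x y z :
  rels (<< x >> - a *: << y >> - << z >>) -> gen x = a *: gen y + gen z.
Proof.
move/pproj_rel/eqP; rewrite !raddfB /= pprojZ -addrA -opprD subr_eq0.
by move/eqP.
Qed.

Lemma presented_ind (P : presented -> Prop) :
  P 0 -> (forall a x q, P q -> P (a *: gen x + q)) -> forall q, P q.
Proof.
move=> P0 PS q; rewrite -(pprojK q) [repr q]monalgE linear_sum.
elim/big_rec: _ => // x y _ Py.
have -> : << (repr q)@_x *g x >> = (repr q)@_x *: << x >>.
  by apply/malgP=> z; rewrite mcoeffZ !mcoeffU mulr_natr.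
by rewrite linearZ; apply: PS.
Qed.

Section Lift.
Variables (M : lmodType k) (f : X -> M).

Definition free_ext (m : {malg k[X]}) : M :=
  \sum_(x <- msupp m) m@_x *: f x.

Lemma free_extE (d : {fset X}) (m : {malg k[X]}) :
  fsubset (msupp m) d ->
  free_ext m = \sum_(x <- d) m@_x *: f x.
Proof.
move=> sd; apply: big_fset_incl => // x _ /mcoeff_outdom ->.
by rewrite scale0r.
Qed.

Lemma free_ext_linear : linear free_ext.
Proof.
move=> a m m'; set d := fsetU (msupp m) (msupp m').
rewrite (@free_extE d m) ?fsubsetUl // (@free_extE d m') ?fsubsetUr //.
rewrite (@free_extE d) ?scaler_sumr -?big_split /=; last first.
  apply: fsubset_trans (msuppD_le _ _) _.
  by apply: fsetUSS => //; apply: msuppZ_le.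
apply: eq_bigr => x _.
by rewrite mcoeffD mcoeffZ scalerDl scalerA.
Qed.

HB.instance Definition _ :=
  GRing.isLinear.Build k {malg k[X]} M _ free_ext free_ext_linear.

Lemma free_extU x : free_ext << x >> = f x.
Proof.
by rewrite /free_ext msuppU oner_eq0 big_seq_fset1 mcoeffUU scale1r.
Qed.

Lemma free_ext_rel a x y z :
  f x = a *: f y + f z -> free_ext (<< x >> - a *: << y >> - << z >>) = 0.
Proof.
by move=> fx; rewrite !raddfB /= linearZ /= !free_extU fx addrAC addrK subrr.
Qed.

Hypothesis f_rels : forall r, rels r -> free_ext r = 0.

Definition lift_fun : presented -> M :=
  locked_with presented_key (fun q => free_ext (repr q)).

Lemma lift_pproj m : lift_fun (pproj m) = free_ext m.
Proof.
apply/eqP; rewrite /lift_fun unlock -subr_eq0 -linearB.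
have /spannedP [s [Ps ->]] : repr (pproj m) - m \in spanned rels.
  by rewrite -pproj_eq pprojK.
rewrite linear_sum big_seq big1 // => p /Ps /f_rels Hp.
by rewrite linearZ /= Hp scaler0.
Qed.

Lemma lift_linear : linear lift_fun.
Proof.
move=> a p q; rewrite -(pprojK p) -(pprojK q) -linearP !lift_pproj.
exact: linearP.
Qed.

HB.instance Definition _ :=
  GRing.isLinear.Build k presented M _ lift_fun lift_linear.

Definition presented_lift : {linear presented -> M} := lift_fun.

Lemma lift_fun_gen x : lift_fun (gen x) = f x.
Proof. by rewrite lift_pproj free_extU. Qed.

Lemma lift_gen x : presented_lift (gen x) = f x.
Proof. exact: lift_fun_gen. Qed.

End Lift.

Lemma eq_linear_gen (M : lmodType k) (g h : {linear presented -> M}) :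
  (forall x, g (gen x) = h (gen x)) -> g =1 h.
Proof.
move=> gh; apply: presented_ind; first by rewrite !linear0.
by move=> a x q IH; rewrite !linearP IH gh.
Qed.

End Presented.

Section Tensor.
Variables (k : comNzRingType) (M N : lmodType k).

Variant tens_rel : {malg k[(M * N)%type]} -> Prop :=
| TensRelL a x x' y :
    tens_rel (<< (a *: x + x', y) >> - a *: << (x, y) >> - << (x', y) >>)
| TensRelR a x y y' :
    tens_rel (<< (x, a *: y + y') >> - a *: << (x, y) >> - << (x, y') >>).

Definition tens := presented tens_rel.
HB.instance Definition _ := GRing.Lmodule.on tens.

Definition ptens (x : M) (y : N) : tens := gen tens_rel (x, y).

Lemma ptens_linearl y : linear (ptens^~ y).
Proof. by move=> a x x'; apply/gen_linear/TensRelL. Qed.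

Lemma ptens_linearr x : linear (ptens x).
Proof. by move=> a y y'; apply/gen_linear/TensRelR. Qed.

HB.instance Definition _ x :=
  GRing.isLinear.Build k N tens _ (ptens x) (ptens_linearr x).

Lemma tens_lift_subproof (L : lmodType k) (f : M -> N -> L) :
  (forall y, linear (f^~ y)) -> (forall x, linear (f x)) ->
  forall r, tens_rel r -> free_ext (fun p => f p.1 p.2) r = 0.
Proof.
by move=> fl fr _ [a x x' y|a x y y']; apply: free_ext_rel; rewrite /= ?fl ?fr.
Qed.

End Tensor.

(* T_k(M): words in elements of M modulo multilinearity in each letter.
   The relations are homogeneous in the length of words, so that this is the
   direct sum over l of the tensor powers of M. *)
Section TensorAlgebra.
Variables (k : comNzRingType) (M : lmodType k).

Variant word_rel : {malg k[seq M]} -> Prop :=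
  WordRel w a x y w' :
    word_rel (<< w ++ (a *: x + y) :: w' >> - a *: << w ++ x :: w' >>
              - << w ++ y :: w' >>).

Definition tensor_algebra := presented word_rel.
HB.instance Definition _ := GRing.Lmodule.on tensor_algebra.

Definition word (w : seq M) : tensor_algebra := gen word_rel w.

Lemma word_linear w w' : linear (fun x => word (w ++ x :: w')).
Proof. by move=> a x y; apply/gen_linear/WordRel. Qed.

End TensorAlgebra.

(* tens A N as a left A-module, through its left factor *)
Section LeftTensor.
Variables (k : comNzRingType) (A : comAlgType k) (N : lmodType k).

Definition ltens := tens A N.
HB.instance Definition _ := Choice.on ltens.
HB.instance Definition _ := GRing.Zmodule.on ltens.

Definition lpure (s : A) (t : N) : ltens := ptens s t.

Lemma lscale_subproof (s : A) r :
  tens_rel r -> free_ext (fun p : A * N => ptens (s * p.1) p.2) r = 0.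
Proof.
apply: (tens_lift_subproof (f := fun x y => ptens (s * x) y)) => [y|x] a u v.
  by rewrite mulrDr -scalerAr ptens_linearl.
exact: linearP.
Qed.

Definition lscale (s : A) : {linear tens A N -> tens A N} :=
  presented_lift (lscale_subproof s).

Lemma lscale_pure s x y : lscale s (ptens x y) = ptens (s * x) y.
Proof. exact: lift_gen. Qed.

Lemma lscale_linearl q : linear (lscale^~ q).
Proof.
move=> a s s'; elim/presented_ind: q => [|b [x y] q IH].
  by rewrite !linear0 addr0.
rewrite !linearP -/(ptens x y) IH !lscale_pure mulrDl -scalerAl ptens_linearl.
by rewrite !scalerDr !scalerA mulrC addrACA.
Qed.

Lemma lscaleA s s' (q : ltens) : lscale s (lscale s' q) = lscale (s * s') q.
Proof.
elim/presented_ind: q => [|b [x y] q IH]; first by rewrite !linear0.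
by rewrite !linearP -/(ptens x y) IH !lscale_pure mulrA.
Qed.

Lemma lscale1 (q : ltens) : lscale 1 q = q.
Proof.
elim/presented_ind: q => [|b [x y] q IH]; first by rewrite !linear0.
by rewrite !linearP -/(ptens x y) IH lscale_pure mul1r.
Qed.

Lemma lscaleDr s (p q : ltens) : lscale s (p + q) = lscale s p + lscale s q.
Proof. exact: linearD. Qed.

Lemma lscaleDl (q : ltens) s s' : lscale (s + s') q = lscale s q + lscale s' q.
Proof. by have := lscale_linearl q 1 s s'; rewrite !scale1r. Qed.

HB.instance Definition _ := GRing.Zmodule_isLmodule.Build A ltens
  lscaleA lscale1 lscaleDr lscaleDl.

Lemma lscale_lpure (s x : A) (y : N) : s *: lpure x y = lpure (s * x) y.
Proof. exact: lscale_pure. Qed.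

End LeftTensor.

Section Differential.
Variables (k : comNzRingType) (A : comAlgType k).
Local Notation T := (tensor_algebra A).

Definition decons_word (w : seq A) : tens A T :=
  if w is x :: w' then ptens x (word w') else 0.

Lemma decons_word_subproof r : word_rel r -> free_ext decons_word r = 0.
Proof.
case=> w a x y w'; apply: free_ext_rel; case: w => [|z w] /=.
  exact: ptens_linearl.
by rewrite word_linear linearP.
Qed.

Definition decons : {linear T -> tens A T} := presented_lift decons_word_subproof.

Lemma decons_wordE w : decons (word w) = decons_word w.
Proof. exact: lift_gen. Qed.

Lemma partial_subproof r :
  tens_rel r ->
  free_ext (fun p : A * T => lscale T p.1 (decons p.2)) r = 0.
Proof.
apply: (tens_lift_subproof (f := fun s t => lscale T s (decons t))) => [t|s].
  exact: lscale_linearl.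
by move=> a t t'; rewrite !linearP.
Qed.

(* s (x) t |-> s . decons t; see partial_word and partial_nil *)
Definition partial_fun (q : ltens A T) : ltens A T := presented_lift partial_subproof q.

Lemma partial_lpure s t : partial_fun (lpure s t) = s *: (decons t : ltens A T).
Proof. exact: (lift_gen partial_subproof (s, t)). Qed.

Lemma partial_linear : linear partial_fun.
Proof.
have addP : {morph partial_fun : p q / p + q} by move=> p q; apply: linearD.
move=> a p q; rewrite addP; congr (_ + _).
elim/presented_ind: p => [|b [x y] p IH].
  by rewrite [a *: _]linear0 [partial_fun 0]linear0 scaler0.
rewrite scalerDr !addP scalerDr IH; congr (_ + _).
have swap (u : A) (r : tens A T) : u *: (b *: r : ltens A T) =
    b *: (u *: (r : ltens A T) : tens A T).
  exact: (linearZ_LR (lscale T u)).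
rewrite swap; transitivity (b *: (partial_fun (a *: lpure x y) : tens A T)).
  exact: linearZ_LR.
rewrite lscale_lpure !partial_lpure -scalerA -swap; congr (a *: _).
rewrite /partial_fun linearZ_LR; congr (b *: _).
by rewrite -partial_lpure.
Qed.

HB.instance Definition _ :=
  GRing.isLinear.Build A (ltens A T) (ltens A T) _ partial_fun partial_linear.

Definition partial : {linear ltens A T -> ltens A T} := partial_fun.

Lemma partial_word s s1 w :
  partial (lpure s (word (s1 :: w))) = lpure (s * s1) (word w).
Proof. by rewrite /= partial_lpure decons_wordE; apply: lscale_lpure. Qed.

Lemma partial_nil s : partial (lpure s (word [::])) = 0.
Proof. by rewrite /= partial_lpure decons_wordE scaler0. Qed.

End Differential.

Section CellTensors.
Variables (k : comNzRingType) (V : lmodType k) (I : finType).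

Definition upd (v : {ffun I -> V}) (c : I) (x : V) : {ffun I -> V} :=
  [ffun d => if d == c then x else v d].

Variant cell_rel : {malg k[{ffun I -> V}]} -> Prop :=
  CellRel v c a x y :
    cell_rel (<< upd v c (a *: x + y) >> - a *: << upd v c x >>
              - << upd v c y >>).

(* The tensor power of V with positions indexed by I *)
Definition cell_tensor := presented cell_rel.
HB.instance Definition _ := GRing.Lmodule.on cell_tensor.

Variables (J : eqType) (col : I -> J).

Variant wedge_rel : {malg k[{ffun I -> V}]} -> Prop :=
| WedgeLin r : cell_rel r -> wedge_rel r
| WedgeAlt (v : {ffun I -> V}) c d : c != d -> col c = col d -> v c = v d -> wedge_rel << v >>.

(* The tensor product, over the fibres C of col, of the exterior powers of V
   of degree #|C|: families of vectors indexed by I, modulo multilinearity and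
   vanishing whenever two entries in the same fibre agree *)
Definition wedge_tensor := presented wedge_rel.
HB.instance Definition _ := GRing.Lmodule.on wedge_tensor.

(* The permutations in the product of the symmetric groups of the fibres; the
   sign of w is the product of the signs of its factors *)
Definition col_perm (w : {perm I}) := [forall c, col (w c) == col c].

Definition antisym_fun (v : {ffun I -> V}) : cell_tensor :=
  \sum_(w : {perm I} | col_perm w)
     (-1) ^+ w *: gen cell_rel [ffun c => v (w c)].

Lemma antisym_subproof r : wedge_rel r -> free_ext antisym_fun r = 0.
Proof.
case=> [_ [v c a x y]|v c d cd col_cd v_cd].
  apply: free_ext_rel; rewrite /antisym_fun scaler_sumr -big_split /=.
  apply: eq_bigr => w _; rewrite scalerA mulrC -scalerA -scalerDr; congr (_ *: _).
  have updw z : [ffun e => upd v c z (w e)] =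
      upd [ffun e => v (w e)] ((w^-1)%g c) z.
    by apply/ffunP=> e; rewrite !ffunE (canF_eq (permK w)).
  by rewrite !updw; apply/gen_linear/CellRel.
rewrite free_extU /antisym_fun; set t := tperm c d.
have vt e : v (t e) = v e by rewrite /t; case: tpermP => // ->.
have ct w : col_perm (w * t)%g = col_perm w.
  apply: eq_forallb => e; rewrite permM; congr (_ == _).
  by rewrite /t; case: tpermP => // ->.
have oddt w : odd_perm (w * t)%g = ~~ odd_perm w.
  by rewrite odd_permM odd_tperm cd addbT.
rewrite (bigID (@odd_perm I)) /= addrC.
apply/eqP; rewrite addr_eq0; apply/eqP.
rewrite (reindex_inj (mulIg t)) /= -sumrN; apply: eq_big => w.
  by rewrite ct oddt negbK.
move=> _; rewrite oddt signrN scaleNr; congr (- (_ *: gen _ _)).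
by apply/ffunP=> e; rewrite !ffunE permM vt.
Qed.

Definition antisym : {linear wedge_tensor -> cell_tensor} :=
  presented_lift antisym_subproof.

End CellTensors.

Import mpoly.

(* Cells are pairs (row, column), with rows numbered from top to bottom *)
Definition diagram := {fset (nat * nat)}.

Definition row_of (D : diagram) (c : D) : nat := (val c).1.
Definition col_of (D : diagram) (c : D) : nat := (val c).2.

(* The indices of the nonempty rows, from the bottom row to the top row *)
Definition rows (D : diagram) : seq nat :=
  sort geq (undup [seq row_of c | c <- enum {: D}]).

Section Schur.
Variables (k : comNzRingType) (n : nat) (D : diagram).
Local Notation V := 'rV[k]_n.
Local Notation S := {mpoly k[n]}.

Definition linear_form (v : V) : S := \sum_(i < n) v 0 i *: 'X_i.

Lemma linear_form_linear : linear linear_form.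
Proof.
move=> a u v; rewrite /linear_form scaler_sumr -big_split /=.
by apply: eq_bigr => i _; rewrite !mxE scalerDl scalerA.
Qed.

Definition row_monomial (v : {ffun D -> V}) (i : nat) : S :=
  \prod_(c : D | row_of c == i) linear_form (v c).

Definition row_word (v : {ffun D -> V}) : tensor_algebra S :=
  word [seq row_monomial v i | i <- rows D].

Lemma row_monomial_upd v c x i : row_monomial (upd v c x) i =
  if row_of c == i then
    linear_form x * \prod_(d : D | (row_of d == i) && (d != c)) linear_form (v d)
  else row_monomial v i.
Proof.
rewrite /row_monomial; case: ifP => [ci|/negbT ci].
  rewrite (bigD1 c) //= ffunE eqxx; congr (_ * _).
  by apply: eq_bigr => d /andP[_ /negbTE dc]; rewrite ffunE dc.
apply: eq_bigr => d /eqP di; rewrite ffunE.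
by case: eqP => // dc; rewrite -dc di eqxx in ci.
Qed.

Lemma row_word_subproof r : cell_rel r -> free_ext row_word r = 0.
Proof.
case=> v c a x y; apply: free_ext_rel.
have rc : row_of c \in rows D.
  by rewrite mem_sort mem_undup map_f // mem_enum.
have us : uniq (rows D) by rewrite sort_uniq undup_uniq.
move: rc us; move rowsE: (rows D) => s rc.
case/path.splitPr: rc rowsE => r1 r2 rowsE us.
have rest z (t : seq nat) : row_of c \notin t ->
    [seq row_monomial (upd v c z) i | i <- t] = [seq row_monomial v i | i <- t].
  move=> ct; apply/eq_in_map => i it; rewrite row_monomial_upd.
  by case: eqP => // ci; rewrite ci it in ct.
move: us; rewrite cat_uniq /= => /and3P[_ /norP[c1 _] /andP[c2 _]].
have row_wordE z : row_word (upd v c z) = word (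
    [seq row_monomial v i | i <- r1] ++
    (linear_form z *
       \prod_(d : D | (row_of d == row_of c) && (d != c)) linear_form (v d)) ::
    [seq row_monomial v i | i <- r2]).
  rewrite /row_word rowsE map_cat /= (rest _ _ c1) (rest _ _ c2).
  by rewrite row_monomial_upd eqxx.
by rewrite !row_wordE linear_form_linear mulrDl -scalerAl word_linear.
Qed.

(* Multiplies together the entries of each row.  The tensor product of the
   S_{|R_i|}, i = 1..p, is regarded as a submodule of the p-th tensor power
   of S. *)
Definition multiply_rows : {linear cell_tensor V D -> tensor_algebra S} :=
  presented_lift row_word_subproof.

Definition schur : {pred tensor_algebra S} := fun t =>
  `[< exists x : wedge_tensor V (@col_of D),
        t = multiply_rows (antisym V (@col_of D) x) >].

Lemma schur_submod_closed : submod_closed schur.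
Proof.
split=> [|a t u /asboolP [x ->] /asboolP [y ->]]; apply/asboolP.
  by exists 0; rewrite !linear0.
by exists (a *: x + y); rewrite !linearP.
Qed.

End Schur.

(* The i-th row from the bottom (i >= 0) of the ribbon starts at column
   \sum_(j < i) (al_j - 1), so that consecutive rows overlap in one column *)
Definition ribbon (al : seq nat) : diagram :=
  [fset c | c in [seq ((size al).-1 - i, sumn [seq a.-1 | a <- take i al] + j)%N
                 | i <- iota 0 (size al), j <- iota 0 (nth 0%N al i)]]%fset.

Definition is_composition (al : seq nat) := all (fun a => 0 < a)%N al.

Section RibbonComplex.
Variables (k : comNzRingType) (n : nat).
Local Notation S := {mpoly k[n]}.
Local Notation T := (tensor_algebra S).

(* The sum over the compositions al of length l of the Schur functors *)
Definition ribbon_space (l : nat) : {pred T} :=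
  spanned (fun t : T => exists al : seq nat,
    [/\ size al = l, is_composition al & t \in schur (ribbon al)]).

(* The image of S (x) ribbon_space l in S (x) T *)
Definition ribbon_term (l : nat) : {pred ltens S T} :=
  spanned (fun x : ltens S T => exists s t, t \in ribbon_space l /\ x = lpure s t).

Definition ribbon_complex : {pred ltens S T} :=
  spanned (fun x : ltens S T => exists l, x \in ribbon_term l).

HB.instance Definition _ := GRing.SubmodClosed.on ribbon_complex.

End RibbonComplex.

Arguments ribbon_space k n l : clear implicits.
Arguments ribbon_term k n l : clear implicits.
Arguments ribbon_complex k n : clear implicits.

(* Main.v *)
Require Import Defs.
From HB Require Import structures.
From mathcomp Require Import all_boot all_order perm all_algebra.
From mathcomp Require Import finmap boolp zify.
From mathcomp.multinomials Require Import mpoly.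
(* [matrix] exports another [col_perm]; here it is the predicate on permutations
   of cells. *)
Import Defs.

(** The complex is generated over S by the elements
      1 (x) sum_w sgn(w) m_1(w) (x) ... (x) m_l(w),
    one for each composition alpha of length l and each filling of the cells of
    the ribbon of alpha by linear forms.  Here w runs over the permutations of
    the cells that preserve columns, and m_i(w) is the product of the i-th row
    from the bottom of the filling permuted by w.  As d is S-linear, it is
    enough to apply d to these generators, where it turns m_1(w) into a
    coefficient.

    (i) The coefficient m_1(w) depends only on the restriction of w to the
    bottom row.  Two column permutations with the same restriction differ by a
    column permutation h fixing the bottom row pointwise, that is, by a column
    permutation of the diagram without its bottom row, of the same sign
    ([sum_ext_perm], [odd_ext_perm]).  So the terms with a given restriction
    add up to a coefficient times a generator attached to the smaller diagram
    ([d_antisym_word]).  For the ribbon of (a, alpha), the smaller diagram is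
    the ribbon of alpha, moved by a - 1 columns ([ribbon_shift]).

    (ii) After two steps the coefficient is m_1(w) m_2(w), the product of all
    the entries in the two lowest rows.  These rows of a ribbon share a column.
    Let t exchange their two cells in that column: it is an odd column
    permutation which moves entries only within the two lowest rows, so that the
    terms of w and t w are opposite ([d2_antisym_word]).

    The computation is made for fillings by elements of any commutative algebra
    A over k; linear forms enter through the identification of the complex with
    the span of such generators ([ribbon_complex_subset],
    [ribbon_span_subset]). *)

Set Implicit Arguments.
Unset Strict Implicit.
Unset Printing Implicit Defensive.

Import GRing.Theory.
Local Open Scope ring_scope.

(** * Submodules and pure tensors *)

Lemma spanned_sub (R : pzRingType) (M : lmodType R) (Q : M -> Prop)
    (P : {pred M}) :
  submod_closed P -> (forall x, Q x -> x \in P) -> {subset spanned Q <= P}.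
Proof.
move=> [P0 PZD] QP x /spannedP[s [Qs ->]]; rewrite big_seq.
elim/big_rec: _ => // p y ps Py; exact/PZD/Py/QP/Qs.
Qed.

Lemma zero_submod_closed (R : pzRingType) (M : lmodType R) :
  submod_closed (pred1 (0 : M)).
Proof.
split=> [|a x y]; rewrite !inE // => /eqP-> /eqP->.
by rewrite scaler0 addr0.
Qed.

Lemma preim_submod_closed (R : pzRingType) (M N : lmodType R)
    (g : {linear M -> N}) (C : {pred N}) :
  submod_closed C -> submod_closed [pred x | g x \in C].
Proof.
move=> [C0 CZD]; split=> [|a x y]; rewrite !inE ?linear0 // linearP.
exact: CZD.
Qed.

Lemma raddf_signed_sum (R R' : pzRingType) (N : lmodType R) (M : lmodType R')
    (g : {additive N -> M}) (I : finType) (P : pred I) (e : I -> bool)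
    (t : I -> N) :
  g (\sum_(i | P i) (-1) ^+ e i *: t i)
  = \sum_(i | P i) (-1) ^+ e i *: g (t i).
Proof.
rewrite raddf_sum; apply: eq_bigr => i _; rewrite !scaler_sign.
by case: e; rewrite ?raddfN.
Qed.

Lemma linear_signed_sum (R : pzRingType) (M M' : lmodType R)
    (g : {linear M -> M'}) (I : finType) (P : pred I) (e : I -> bool)
    (x : I -> M) :
  g (\sum_(i | P i) (-1) ^+ e i *: x i)
  = \sum_(i | P i) (-1) ^+ e i *: g (x i).
Proof. by rewrite linear_sum; apply: eq_bigr => i _; rewrite linearZ. Qed.

Section PureTensors.
Variables (k : comNzRingType) (A : comAlgType k) (N : lmodType k).

Fact lpure_nmod_morphism (s : A) : nmod_morphism (@lpure k A N s).
Proof. by split; [exact: (linear0 (ptens s)) | exact: (linearD (ptens s))]. Qed.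

HB.instance Definition _ (s : A) :=
  GRing.isNmodMorphism.Build N (ltens A N) (@lpure k A N s)
    (lpure_nmod_morphism s).

Lemma lpure0l (t : N) : lpure (0 : A) t = 0.
Proof. by rewrite -[X in lpure X t](mul0r (0 : A)) -lscale_lpure scale0r. Qed.

(** The scalars of k act on S (x) N through their image in S, so that a
    submodule over S pulls back to a submodule over k along t |-> s (x) t. *)
Lemma lpureZr (s : A) (a : k) (t : N) : lpure s (a *: t) = a%:A *: lpure s t.
Proof.
rewrite lscale_lpure -scalerAl mul1r.
transitivity (a *: (lpure s t : tens A N)); first exact: (linearZ_LR (ptens s)).
by have := ptens_linearl t a s 0; rewrite addr0 [X in _ = _ + X]lpure0l addr0.
Qed.

End PureTensors.

(** * Column permutations extended along an injection *)

(** A diagram without its bottom row is included in the full diagram by some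
    [phi]; [ext_perm] makes its permutations into permutations of the full
    diagram that fix the bottom row. *)

Section ExtPerm.
Variables (I' I : finType) (phi : I' -> I).
Hypothesis phi_inj : injective phi.

Definition ext_fun (w : {perm I'}) (x : I) : I :=
  if [pick c | phi c == x] is Some c then phi (w c) else x.

Lemma ext_fun_in w c : ext_fun w (phi c) = phi (w c).
Proof.
rewrite /ext_fun; case: pickP => [d /eqP/phi_inj -> //|/(_ c)].
by rewrite eqxx.
Qed.

Lemma ext_fun_out w x : x \notin codom phi -> ext_fun w x = x.
Proof.
rewrite /ext_fun; case: pickP => // c /eqP <-.
by rewrite codom_f.
Qed.

Lemma ext_fun_inj w : injective (ext_fun w).
Proof.
apply: (can_inj (g := ext_fun w^-1)) => x.
have [/codomP[c ->]|xN] := boolP (x \in codom phi).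
  by rewrite !ext_fun_in permK.
by rewrite !ext_fun_out.
Qed.

Definition ext_perm w : {perm I} := perm (@ext_fun_inj w).

Lemma ext_perm_in w c : ext_perm w (phi c) = phi (w c).
Proof. by rewrite permE ext_fun_in. Qed.

Lemma ext_perm_out w x : x \notin codom phi -> ext_perm w x = x.
Proof. by rewrite permE; apply: ext_fun_out. Qed.

Lemma eq_ext_perm (w : {perm I'}) (h : {perm I}) :
  (forall c, h (phi c) = phi (w c)) ->
  (forall x, x \notin codom phi -> h x = x) -> h = ext_perm w.
Proof.
move=> hin hout; apply/permP=> x.
have [/codomP[c ->]|xN] := boolP (x \in codom phi).
  by rewrite hin ext_perm_in.
by rewrite hout // ext_perm_out.
Qed.

Lemma ext_perm_inj : injective ext_perm.
Proof.
move=> u w uw; apply/permP=> c; apply: phi_inj.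
by rewrite -!ext_perm_in uw.
Qed.

Lemma ext_permM u w : ext_perm (u * w)%g = (ext_perm u * ext_perm w)%g.
Proof.
apply/esym/eq_ext_perm => [c|x xN]; rewrite permM.
  by rewrite !ext_perm_in permM.
by rewrite !ext_perm_out.
Qed.

Lemma ext_tperm c d : ext_perm (tperm c d) = tperm (phi c) (phi d).
Proof.
apply/esym/eq_ext_perm => [e|x xN]; first by rewrite inj_tperm.
by rewrite tpermD //; apply: contraNneq xN => <-; apply: codom_f.
Qed.

(** Extension is multiplicative and maps transpositions to transpositions. *)
Lemma odd_ext_perm w : ext_perm w = w :> bool.
Proof.
have [ts -> dts] := prod_tpermP w.
elim: ts dts => [_|t ts IH /= /andP[dt dts]].
  have ext1 : 1%g = ext_perm 1 by apply: eq_ext_perm => *; rewrite !perm1.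
  by rewrite big_nil -ext1 !odd_perm1.
rewrite big_cons ext_permM !odd_permM IH // ext_tperm !odd_tperm.
by rewrite (inj_eq phi_inj).
Qed.

Lemma ext_perm_onto (h : {perm I}) :
  (forall x, x \notin codom phi -> h x = x) -> exists w, h = ext_perm w.
Proof.
move=> hout.
have /fin_all_exists[f hf] c : exists d, h (phi c) = phi d.
  apply/codomP; apply: contraT => hN.
  by move/perm_inj: (hout _ hN) => hc; rewrite hc codom_f in hN.
have f_inj : injective f.
  by move=> c d cd; apply/phi_inj/(@perm_inj _ h); rewrite !hf cd.
by exists (perm f_inj); apply: eq_ext_perm => // c; rewrite permE.
Qed.

Variables (J : eqType) (col' : I' -> J) (col : I -> J).
Hypothesis phi_col : forall c d,
  (col (phi c) == col (phi d)) = (col' c == col' d).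

Lemma col_perm_ext w : col_perm col (ext_perm w) = col_perm col' w.
Proof.
apply/forallP/forallP => /= H x; first by rewrite -phi_col -ext_perm_in.
have [/codomP[c ->]|xN] := boolP (x \in codom phi).
  by rewrite ext_perm_in phi_col.
by rewrite ext_perm_out.
Qed.

(** The column permutations fixing everything outside the image of [phi] are
    exactly the extensions of the column permutations of the smaller diagram. *)
Lemma sum_ext_perm (M : nmodType) (F : {perm I} -> M) :
  \sum_(h | col_perm col h &&
            [forall x, (x \notin codom phi) ==> (h x == x)]) F h
  = \sum_(w | col_perm col' w) F (ext_perm w).
Proof.
rewrite -(big_imset _ (h := ext_perm) (A := [pred w | col_perm col' w])) /=;
  last by move=> u w _ _; apply: ext_perm_inj.
apply: eq_bigl => h; apply/andP/imsetP => [[hc /forall_inP hfix]|[w wc ->]].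
  have [w hw] := @ext_perm_onto h (fun x xN => eqP (hfix x xN)).
  by exists w => //; rewrite inE -col_perm_ext -hw.
split; first by rewrite col_perm_ext.
by apply/forall_inP=> x xN; rewrite ext_perm_out.
Qed.

End ExtPerm.

Lemma col_permM (I : finType) (J : eqType) (col : I -> J) (u w : {perm I}) :
  col_perm col w -> col_perm col (u * w)%g = col_perm col u.
Proof.
move=> /forallP wc; apply: eq_forallb => c; rewrite permM.
by rewrite (eqP (wc _)).
Qed.

Lemma col_permMl (I : finType) (J : eqType) (col : I -> J) (u w : {perm I}) :
  col_perm col u -> col_perm col (u * w)%g = col_perm col w.
Proof.
move=> /forallP uc; apply/forallP/forallP => wc c; last first.
  by rewrite permM (eqP (wc _)).
by rewrite -[c](permKV u) -permM (eqP (wc _)) -(eqP (uc _)).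
Qed.

(** * The differential of an antisymmetrized filling *)

Section Symmetrized.
Variables (k : comNzRingType) (A : comAlgType k).
Local Notation T := (tensor_algebra A).

Definition row_product (D : diagram) (a : {ffun D -> A}) (i : nat) : A :=
  \prod_(c : D | row_of c == i) a c.

Definition antisym_word (D : diagram) (a : {ffun D -> A}) : T :=
  \sum_(w : {perm D} | col_perm (@col_of D) w)
    (-1) ^+ w *: word [seq row_product [ffun c => a (w c)] i | i <- rows D].

(** [iota] stands for t |-> 1 (x) t and [d] for the differential; [d_cons] and
    [d_nil] are all that the computation needs to know about them. *)
Section Differential.
Variables (M : lmodType A) (iota : {additive T -> M}) (d : {linear M -> M}).
Hypothesis d_cons : forall x w, d (iota (word (x :: w))) = x *: iota (word w).

Lemma d_antisym_wordE (D : diagram) r rs (a : {ffun D -> A}) :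
  rows D = r :: rs ->
  d (iota (antisym_word a)) =
  \sum_(w : {perm D} | col_perm (@col_of D) w)
    (-1) ^+ w *: (row_product [ffun c => a (w c)] r *:
      iota (word [seq row_product [ffun c => a (w c)] i | i <- rs])).
Proof.
move=> rowsD; rewrite /antisym_word raddf_signed_sum linear_signed_sum.
by apply: eq_bigr => w _; rewrite rowsD d_cons.
Qed.

Hypothesis d_nil : d (iota (word [::])) = 0.

Lemma d_antisym_word0 (D : diagram) (a : {ffun D -> A}) :
  rows D = [::] -> d (iota (antisym_word a)) = 0.
Proof.
move=> rowsD; rewrite /antisym_word raddf_signed_sum linear_signed_sum.
by rewrite big1 // => w _; rewrite rowsD d_nil scaler0.
Qed.

Lemma d2_antisym_word1 (D : diagram) r (a : {ffun D -> A}) :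
  rows D = [:: r] -> d (d (iota (antisym_word a))) = 0.
Proof.
move=> rowsD; rewrite (d_antisym_wordE _ rowsD) linear_signed_sum.
by rewrite big1 // => w _; rewrite linearZ /= d_nil !scaler0.
Qed.

(** [D'] is [D] without its bottom row [r], up to a renumbering [phi] of the
    columns. *)
Section BottomRow.
Variables (D D' : diagram) (r : nat) (phi : D' -> D).
Hypothesis phi_inj : injective phi.
Hypothesis phi_row : forall c, row_of (phi c) = row_of c.
Hypothesis phi_col : forall c d,
  (col_of (phi c) == col_of (phi d)) = (col_of c == col_of d).
Hypothesis phi_codom : forall x, (x \in codom phi) = (row_of x != r).
Hypothesis rows_D : rows D = r :: rows D'.

Lemma row_product_phi (a : {ffun D -> A}) i : i != r ->
  row_product a i = row_product [ffun c => a (phi c)] i.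
Proof.
move=> ir; rewrite /row_product.
transitivity (\prod_(c in [pred c : D' | row_of c == i]) a (phi c));
  last by apply: eq_bigr => c _; rewrite ffunE.
rewrite -[RHS](big_imset a (h := phi)) /=; last by apply: in2W.
apply: eq_bigl => x; apply/eqP/imsetP => [xi|[c ci ->]]; last first.
  by rewrite phi_row; apply/eqP.
have /codomP[c xc] : x \in codom phi by rewrite phi_codom xi.
by exists c => //; rewrite inE -phi_row -xc xi.
Qed.

(** Removing the bottom row: the column permutations of [D] are grouped by their
    restriction to that row.  Each group is a coset of the column permutations
    of [D'], and contributes a multiple of the antisymmetrized filling of [D']
    by the entries that one member [g] of the group brings to its cells. *)
Lemma d_antisym_word (a : {ffun D -> A}) :
  d (iota (antisym_word a)) \in
  spanned (fun x => exists f : D' -> D,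
             x = iota (antisym_word [ffun c => a (f c)])).
Proof.
rewrite (d_antisym_wordE _ rows_D).
(* [res w] records the restriction of w to the bottom row; its value on the
   other cells is a dummy. *)
pose res (w : {perm D}) := [ffun x => if x \in codom phi then x else w x].
rewrite (partition_big res predT) //=; apply: rpred_sum => f _.
have [g /andP[gc /eqP gf]|none] :=
  pickP (fun w : {perm D} => col_perm (@col_of D) w && (res w == f));
  last first.
  by rewrite big_pred0 ?rpred0.
(* The permutations restricting to f are the h * g with h fixing the bottom
   row pointwise. *)
rewrite (reindex_inj (mulIg g)) /=.
rewrite (eq_bigl (fun h : {perm D} => col_perm (@col_of D) h
   && [forall x, (x \notin codom phi) ==> (h x == x)])); last first.
  move=> h; rewrite col_permM //; congr (_ && _).
  rewrite -gf; apply/eqP/forall_inP => [hg x xN|hfix].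
    move/ffunP/(_ x): hg; rewrite !ffunE (negbTE xN) permM.
    by move/perm_inj->.
  apply/ffunP=> x; rewrite !ffunE; case: ifPn => // xN.
  by rewrite permM (eqP (hfix x xN)).
rewrite (sum_ext_perm phi_inj phi_col).
pose u := [ffun c => a (g (phi c))].
rewrite (eq_bigr (fun w : {perm D'} => ((-1) ^+ g *
     row_product [ffun c => a (g c)] r) *:
   ((-1) ^+ odd_perm w *: iota (word
      [seq row_product [ffun c => u (w c)] i | i <- rows D'])))); last first.
  move=> w _; rewrite odd_permM odd_ext_perm signr_addb !scalerA.
  rewrite [(-1) ^+ w * _]mulrC -!mulrA [_ * (-1) ^+ w]mulrC.
  congr (_ * (_ * _) *: iota _).
    apply: eq_bigr => x /eqP xr; rewrite !ffunE permM ext_perm_out //.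
    by rewrite phi_codom xr eqxx.
  congr word; apply/eq_in_map => i iD'.
  have ir : i != r.
    have : uniq (rows D) by rewrite sort_uniq undup_uniq.
    by rewrite rows_D /= => /andP[+ _]; apply: contraNneq => <-.
  rewrite row_product_phi //; congr row_product.
  by apply/ffunP=> c; rewrite !ffunE permM ext_perm_in.
rewrite -scaler_sumr -raddf_signed_sum.
by rewrite rpredZ // spanned_gen //; exists (g \o phi).
Qed.

End BottomRow.

(** [b] and [c] are cells of the two lowest rows in a common column. *)
Section TwoBottomRows.
Variables (D : diagram) (r1 r2 : nat) (rs : seq nat) (b c : D).
Hypothesis rows_D : rows D = r1 :: r2 :: rs.
Hypotheses (row_b : row_of b = r1) (row_c : row_of c = r2).
Hypothesis col_bc : col_of b = col_of c.

(** The product of the two lowest rows runs over a set of cells that contains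
    both [b] and [c], hence does not see their exchange. *)
Lemma row_product2_tperm (a : {ffun D -> A}) : r1 != r2 ->
  row_product [ffun x => a (tperm b c x)] r1 *
    row_product [ffun x => a (tperm b c x)] r2
  = row_product a r1 * row_product a r2.
Proof.
move=> r12.
have split2 (u : {ffun D -> A}) : row_product u r1 * row_product u r2 =
    \prod_(x : D | (row_of x == r1) || (row_of x == r2)) u x.
  rewrite (bigID (fun x => row_of x == r1)) /=.
  congr (_ * _); apply: eq_bigl => x.
    by case: (row_of x == r1); rewrite ?andbT ?andbF.
  by case: (row_of x =P r1) => [->|_]; rewrite ?(negbTE r12) ?andbT.
rewrite !split2 [RHS](reindex_inj (@perm_inj _ (tperm b c))) /=.
apply: eq_big => x; last by rewrite ffunE.
by case: tpermP => // ->; rewrite row_b row_c !eqxx ?orbT.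
Qed.

Lemma row_product_tperm (a : {ffun D -> A}) i : i != r1 -> i != r2 ->
  row_product [ffun x => a (tperm b c x)] i = row_product a i.
Proof.
move=> i1 i2; apply: eq_bigr => x /eqP xi; rewrite ffunE tpermD //.
  by apply: contraNneq i1 => bx; rewrite -xi -bx row_b.
by apply: contraNneq i2 => cx; rewrite -xi -cx row_c.
Qed.

(** Left multiplication by the transposition of [b] and [c] is a sign-reversing
    involution on the column permutations that leaves the unsigned term
    unchanged, so the terms cancel in pairs. *)
Lemma d2_antisym_word (a : {ffun D -> A}) : d (d (iota (antisym_word a))) = 0.
Proof.
have : uniq (rows D) by rewrite sort_uniq undup_uniq.
rewrite rows_D /= inE negb_or => /and3P[/andP[r12 r1rs] r2rs _].
have bc : b != c by apply: contraNneq r12 => bc; rewrite -row_b -row_c bc.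
rewrite (d_antisym_wordE _ rows_D) linear_signed_sum.
pose F (u : {ffun D -> A}) := (row_product u r1 * row_product u r2) *:
  iota (word [seq row_product u i | i <- rs]).
rewrite (eq_bigr (fun w : {perm D} => (-1) ^+ w *: F [ffun x => a (w x)]));
  last by move=> w _; rewrite linearZ /= d_cons [_ *: (_ *: iota _)]scalerA.
have F_tperm (u : {ffun D -> A}) : F [ffun x => u (tperm b c x)] = F u.
  rewrite /F row_product2_tperm //; congr (_ *: iota (word _)).
  apply/eq_in_map => i irs; apply: row_product_tperm.
    by apply: contraNneq r1rs => <-.
  by apply: contraNneq r2rs => <-.
have colt : col_perm (@col_of D) (tperm b c).
  by apply/forallP=> x; case: tpermP => // ->; rewrite col_bc.
(* Dividing by 2 is not possible in general, so the even terms are matched with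
   the odd ones. *)
rewrite (bigID (fun w : {perm D} => odd_perm w)) /= addrC.
apply/eqP; rewrite addr_eq0; apply/eqP.
rewrite (reindex_inj (mulgI (tperm b c))) /= -sumrN; apply: eq_big => w.
  rewrite odd_permM odd_tperm bc /= negbK; congr (_ && _).
  exact: col_permMl.
move=> _; rewrite odd_permM odd_tperm bc signrN scaleNr; congr (- (_ *: _)).
rewrite -[RHS]F_tperm; congr F.
by apply/ffunP=> x; rewrite !ffunE permM.
Qed.

End TwoBottomRows.
End Differential.
End Symmetrized.

(** * Ribbons *)

Lemma mem_rows (D : diagram) i : (i \in rows D) = [exists c : D, row_of c == i].
Proof.
rewrite mem_sort mem_undup; apply/mapP/existsP => [[c _ ->]|[c /eqP <-]].
  by exists c.
by exists c; rewrite ?mem_enum.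
Qed.

Lemma rows_eq (D : diagram) (s : seq nat) :
  sorted gtn s -> rows D =i s -> rows D = s.
Proof.
move=> s_sorted Ds; apply: (irr_sorted_eq (leT := gtn)) => //.
- by move=> x y z /= xy yz; apply: ltn_trans yz xy.
- by move=> x /=; rewrite ltnn.
by rewrite gtn_sorted_uniq_geq sort_uniq undup_uniq sort_sorted.
Qed.

Lemma mem_ribbon al (r c : nat) : ((r, c) \in ribbon al) =
  has (fun i => (r == (size al).-1 - i) &&
         (sumn [seq a.-1 | a <- take i al] <= c
            < sumn [seq a.-1 | a <- take i al] + nth 0 al i))%N
      (iota 0 (size al)).
Proof.
rewrite in_fset /=; apply/allpairsPdep/hasP => [[i [j [iI]]]|[i iI]].
  rewrite mem_iota => /= jI [-> ->]; exists i => //.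
  by rewrite eqxx leq_addr ltn_add2l.
set m := sumn _ => /andP[/eqP -> /andP[le_c lt_c]]; exists i, (c - m)%N.
by rewrite iI mem_iota -/m subnKC //=; split=> //; lia.
Qed.

(** Rows are numbered from the top, so that the rows of [ribbon al] keep their
    numbers when a new bottom row, of number [size al], is put below them; only
    the columns move. *)
Lemma mem_ribbon_cons a al (r c : nat) : ((r, c) \in ribbon (a :: al)) =
  (r == size al) && (c < a)%N ||
  (a.-1 <= c)%N && ((r, c - a.-1)%N \in ribbon al).
Proof.
rewrite !mem_ribbon /= subn0 add0n; congr (_ || _).
rewrite -[1%N]addn0 iotaDl has_map.
have [ca|ca] := leqP a.-1 c.
  apply: eq_in_has => i; rewrite mem_iota /= => ial.
  rewrite add1n /= add0n; set m := sumn _; congr (_ && _); last by lia.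
  by congr (_ == _); lia.
apply/hasP => -[i _ /=]; rewrite add1n /=.
by rewrite -addnA => /and3P[_ /(leq_trans (leq_addr _ _))]; rewrite leqNgt ca.
Qed.

Lemma ribbon_row_lt al r c : (r, c) \in ribbon al -> (r < size al)%N.
Proof.
rewrite mem_ribbon => /hasP[i]; rewrite mem_iota => ? /andP[/eqP -> _]; lia.
Qed.

Lemma ribbon_corner a al : (0 < a)%N -> (size al, 0%N) \in ribbon (a :: al).
Proof. by move=> a_gt0; rewrite mem_ribbon_cons eqxx a_gt0. Qed.

Lemma ribbon_last a al : (0 < a)%N -> (size al, a.-1) \in ribbon (a :: al).
Proof. by move=> a_gt0; rewrite mem_ribbon_cons eqxx ltn_predL a_gt0. Qed.

(** The parts must be positive, since [rows] only lists nonempty rows. *)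
Lemma rows_ribbon al :
  is_composition al -> rows (ribbon al) = rev (iota 0 (size al)).
Proof.
move=> al_comp; apply: rows_eq; first by rewrite rev_sorted iota_ltn_sorted.
move=> i; rewrite mem_rows mem_rev mem_iota /= add0n.
apply/idP/idP => [/existsP[[[r c] rcD] /eqP <-]|].
  exact: ribbon_row_lt rcD.
suff suff : (i < size al)%N -> exists c, (i, c) \in ribbon al.
  by move=> /[dup] /suff[c cD] _; apply/existsP; exists [` cD]%fset => /=.
elim: al al_comp => //= a al IH /andP[a_gt0 al_comp].
rewrite ltnS leq_eqVlt => /predU1P[->|/(IH al_comp)[c cD]].
  by exists 0%N; apply: ribbon_corner.
exists (a.-1 + c)%N.
by rewrite mem_ribbon_cons leq_addr addKn cD orbT.
Qed.

Lemma rows_ribbon_cons a al : is_composition (a :: al) ->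
  rows (ribbon (a :: al)) = size al :: rows (ribbon al).
Proof.
move=> aal_comp; have /andP[_ al_comp] := aal_comp.
by rewrite !rows_ribbon // [size (_ :: _)]/= -addn1 iotaD rev_cat.
Qed.

Section RibbonShift.
Variables (a : nat) (al : seq nat).

Fact ribbon_shift_subproof (x : ribbon al) :
  (row_of x, a.-1 + col_of x)%N \in ribbon (a :: al).
Proof.
by rewrite mem_ribbon_cons leq_addr addKn -surjective_pairing fsvalP orbT.
Qed.

Definition ribbon_shift (x : ribbon al) : ribbon (a :: al) :=
  [` ribbon_shift_subproof x]%fset.

Lemma ribbon_shift_inj : injective ribbon_shift.
Proof.
move=> x y /(congr1 val)[xy_row /addnI xy_col].
exact/val_inj/(injective_projections _ _ xy_row xy_col).
Qed.

Lemma ribbon_shift_codom x :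
  (x \in codom ribbon_shift) = (row_of x != size al).
Proof.
apply/idP/idP => [/codomP[[[r c] cD] ->]|].
  by rewrite neq_ltn (ribbon_row_lt cD).
case: x => -[r c] rcD; rewrite /row_of /= => r_al; apply/codomP.
have := rcD; rewrite mem_ribbon_cons (negbTE r_al) /= => /andP[ac cD].
by exists [` cD]%fset; apply/val_inj; rewrite /= /row_of /col_of /= subnKC.
Qed.

End RibbonShift.

(** * The complex spanned by antisymmetrized fillings of ribbons *)

Section RibbonDifferential.
Variables (k : comNzRingType) (A : comAlgType k).
Variable F : A -> Prop.
Local Notation T := (tensor_algebra A).
Local Notation unit_tens := (@lpure k A T 1 : {additive T -> ltens A T}).

(** When A is the polynomial ring and [F] singles out the linear forms, this is
    the ribbon complex. *)
Definition ribbon_span : {pred ltens A T} :=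
  spanned (fun y => exists al (x : {ffun ribbon al -> A}),
    [/\ is_composition al, forall c, F (x c) & y = lpure 1 (antisym_word x)]).

Lemma ribbon_span_closed : submod_closed ribbon_span.
Proof. exact: spanned_submod_closed. Qed.

Lemma ribbon_span_gen al (x : {ffun ribbon al -> A}) :
  is_composition al -> (forall c, F (x c)) ->
  lpure 1 (antisym_word x) \in ribbon_span.
Proof. by move=> al_comp Fx; apply: spanned_gen; exists al, x. Qed.

Lemma ribbon_span_sub (P : {pred ltens A T}) :
  submod_closed P ->
  (forall al (x : {ffun ribbon al -> A}), is_composition al ->
     (forall c, F (x c)) -> lpure 1 (antisym_word x) \in P) ->
  {subset ribbon_span <= P}.
Proof.
move=> PS Pgen; apply: (spanned_sub PS) => _ [al [x [al_comp Fx ->]]].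
exact: Pgen.
Qed.

Lemma partial_unit_cons (x : A) (w : seq A) :
  partial A (lpure 1 (word (x :: w))) = x *: lpure 1 (word w).
Proof. by rewrite partial_word lscale_lpure mul1r mulr1. Qed.

Lemma partial_unit_nil : partial A (lpure 1 (word [::])) = 0.
Proof. exact: partial_nil. Qed.

Lemma partial_ribbon_nil (x : {ffun ribbon [::] -> A}) :
  partial A (lpure 1 (antisym_word x)) = 0.
Proof.
exact: (@d_antisym_word0 k A _ unit_tens (partial A) partial_unit_nil
  _ x (rows_ribbon (al := [::]) isT)).
Qed.

Lemma partial_antisym_word_ribbon al (x : {ffun ribbon al -> A}) :
  is_composition al -> (forall c, F (x c)) ->
  partial A (lpure 1 (antisym_word x)) \in ribbon_span.
Proof.
case: al x => [|a al] x al_comp Fx.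
  by rewrite partial_ribbon_nil /ribbon_span rpred0.
have := @d_antisym_word k A _ unit_tens (partial A) partial_unit_cons
  _ _ _ _ (@ribbon_shift_inj a al) (fun=> erefl)
  (fun c d => eqn_add2l _ _ _) (@ribbon_shift_codom a al)
  (rows_ribbon_cons al_comp) x.
apply: spanned_sub => [|_ [f ->]]; first exact: spanned_submod_closed.
apply: spanned_gen; exists al, [ffun c => x (f c)].
by split=> // [|c]; [case/andP: al_comp | rewrite ffunE].
Qed.

(** Ribbons with at most one row have no two rows to exchange cells between, but
    there the differential runs out of rows after two steps. *)
Lemma partial2_antisym_word_ribbon al (x : {ffun ribbon al -> A}) :
  is_composition al ->
  partial A (partial A (lpure 1 (antisym_word x))) = 0.
Proof.
case: al x => [|a [|b al]] x al_comp.
- by rewrite partial_ribbon_nil linear0.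
- exact: (@d2_antisym_word1 k A _ unit_tens (partial A)
    partial_unit_cons partial_unit_nil _ _ x (rows_ribbon al_comp)).
have /and3P[a_gt0 b_gt0 _] := al_comp.
have rows_abal := rows_ribbon_cons al_comp.
have /andP[_ bal_comp] := al_comp.
rewrite (rows_ribbon_cons bal_comp) in rows_abal.
have bD : (size (b :: al), a.-1) \in ribbon [:: a, b & al].
  exact: ribbon_last.
(* The last cell of the bottom row lies below the first cell of the next row. *)
have cD : (size al, a.-1) \in ribbon [:: a, b & al].
  by rewrite mem_ribbon_cons leqnn subnn ribbon_corner // orbT.
exact: (@d2_antisym_word k A _ unit_tens (partial A) partial_unit_cons
  _ _ _ _ [` bD]%fset [` cD]%fset rows_abal erefl erefl erefl x).
Qed.

Lemma partial_ribbon_span y : y \in ribbon_span -> partial A y \in ribbon_span.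
Proof.
apply: (spanned_sub
  (preim_submod_closed (partial A) (spanned_submod_closed _))).
by move=> _ [al [x [al_comp Fx ->]]]; apply: partial_antisym_word_ribbon.
Qed.

Lemma partial2_ribbon_span y : y \in ribbon_span -> partial A (partial A y) = 0.
Proof.
move=> yR; apply/eqP; move: y yR; apply: (spanned_sub (preim_submod_closed
  (partial A) (preim_submod_closed (partial A) (@zero_submod_closed _ _)))).
move=> _ [al [x [al_comp _ ->]]]; rewrite !inE.
by rewrite partial2_antisym_word_ribbon.
Qed.

End RibbonDifferential.

(** * The ribbon complex of a polynomial ring *)

Section Conclusion.
Variables (k : comNzRingType) (n : nat).
Local Notation V := 'rV[k]_n.
Local Notation S := {mpoly k[n]}.
Local Notation T := (tensor_algebra S).
Local Notation L := (ltens S T).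

(** The image of a generator of the tensor product of exterior powers. *)
Lemma multiply_rows_antisym (D : diagram) (v : {ffun D -> V}) :
  multiply_rows k n D (antisym V (@col_of D) (gen _ v))
  = antisym_word [ffun c => linear_form (v c)].
Proof.
rewrite /antisym lift_gen /antisym_fun linear_sum.
apply: eq_bigr => w _; rewrite linearZ /=; congr (_ *: _).
transitivity (row_word [ffun c => v (w c)]).
  exact: (lift_fun_gen (@row_word_subproof k n D)).
congr word; apply: eq_map => i; apply: eq_bigr => c _.
by rewrite !ffunE.
Qed.

Definition is_linear_form (f : S) : Prop := exists v : V, f = linear_form v.

(** The three nested spans defining the complex, over S, S and k, collapse to a
    single S-span, because 1 (x) t determines all the s (x) t. *)
Lemma ribbon_complex_sub (P : {pred L}) :
  submod_closed P ->
  (forall al (v : {ffun ribbon al -> V}),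
     is_composition al ->
     lpure (1 : S) (antisym_word [ffun c => linear_form (v c)]) \in P) ->
  {subset ribbon_complex k n <= P}.
Proof.
move=> PS Pgen; have [P0 PZD] := PS.
apply: spanned_sub => // x [l]; move: x.
apply: spanned_sub => // _ [s [t [tl ->]]].
rewrite -[s]mulr1 -lscale_lpure -[_ *: _]addr0; apply: (PZD) => //.
pose P1 := [pred t : T | lpure (1 : S) t \in P].
have P1S : submod_closed P1.
  split=> [|a u u']; rewrite !inE; first by rewrite raddf0.
  by rewrite raddfD /= lpureZr; apply: (PZD).
suff /(_ t tl) : {subset ribbon_space k n l <= P1} by rewrite inE.
apply: (spanned_sub P1S) => _ [al [_ al_comp /asboolP[x ->]]].
have [P10 P1ZD] := P1S.
elim/presented_ind: x => [|a v x IH]; first by rewrite !linear0.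
rewrite linearP linearP; apply: (P1ZD); last exact: IH.
rewrite inE multiply_rows_antisym; exact: (Pgen al v al_comp).
Qed.

Lemma antisym_word_ribbon_complex al (v : {ffun ribbon al -> V}) :
  is_composition al ->
  lpure (1 : S) (antisym_word [ffun c => linear_form (v c)])
    \in ribbon_complex k n.
Proof.
move=> al_comp; apply: spanned_gen; exists (size al); apply: spanned_gen.
exists 1; eexists; split; last by [].
apply: spanned_gen; exists al; split=> //; apply/asboolP; eexists.
exact/esym/multiply_rows_antisym.
Qed.

Lemma ribbon_complex_subset :
  {subset ribbon_complex k n <= ribbon_span is_linear_form}.
Proof.
apply: ribbon_complex_sub; first exact: ribbon_span_closed.
move=> al v al_comp; apply: ribbon_span_gen => // c.
by rewrite ffunE; eexists.
Qed.

Lemma ribbon_span_subset :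
  {subset ribbon_span is_linear_form <= ribbon_complex k n}.
Proof.
apply: ribbon_span_sub; first exact: spanned_submod_closed.
move=> al x al_comp /fin_all_exists[v xv].
rewrite (_ : x = [ffun c => linear_form ([ffun c => v c] c)]).
  exact: antisym_word_ribbon_complex.
by apply/ffunP=> c; rewrite !ffunE.
Qed.

End Conclusion.

Theorem proposition4p2 (k : comNzRingType) (n : nat) :
  (forall x : ltens {mpoly k[n]} (tensor_algebra {mpoly k[n]}),
     x \in ribbon_complex k n ->
     partial {mpoly k[n]} x \in ribbon_complex k n) /\
  (forall x : ltens {mpoly k[n]} (tensor_algebra {mpoly k[n]}),
     x \in ribbon_complex k n ->
     partial {mpoly k[n]} (partial {mpoly k[n]} x) = 0).
Proof.
split=> x /ribbon_complex_subset xR.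
  exact/ribbon_span_subset/partial_ribbon_span.
exact: partial2_ribbon_span xR.
Qed.
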